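(* Let $F$ be a field of characteristic $\neq2$ which is not formally real and satisfies $|\dot F/\dot F^2|=2^n$. Let $\mathcal{R}\subset H^*(\mathcal{G}_F,\mathbb{F}_2)$ be the subring generated by $H^1(\mathcal{G}_F,\mathbb{F}_2)$ and let $c(F)$ be the largest degree in which $\mathcal{R}$ has a nonzero element. Then $c(F)\le n$.
   Context: $\dot F=F^\times$; $\mathcal{G}_F=G_F/G_F^4[G_F^2,G_F]$ is the W-group of $F$, $G_F$ being the Galois group of the quadratic closure of $F$. Formally real means $-1$ is not a sum of squares. *)

(* Defs.v *)
From HB Require Import structures.
From mathcomp Require Import all_boot all_order all_algebra all_fingroup all_field.
Set Implicit Arguments. Unset Strict Implicit. Unset Printing Implicit Defensive.
Import GRing.Theory.
Local Open Scope ring_scope.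

Definition formally_real (F : fieldType) : Prop :=
  ~ exists s : seq F, -1 = \sum_(x <- s) x ^+ 2.

Definition is_square (F : fieldType) (x : F) : Prop := exists y : F, x = y ^+ 2.

Definition square_class_card (F : fieldType) (N : nat) : Prop :=
  exists f : 'I_N -> F,
    [/\ forall i, f i != 0,
        forall i j, is_square (f i / f j) -> i = j
      & forall x : F, x != 0 -> exists i, is_square (x / f i)].

(* The group laws x^4 = 1 and [x^2, y] = 1, i.e. G^4[G^2,G] = 1. *)
Definition W_laws (gT : finGroupType) (G : {set gT}) : Prop :=
  forall x y, x \in G -> y \in G -> (x ^+ 4 = 1)%g /\ commute (x ^+ 2)%g y.

(* L is (a model of) F^{(3)}, the fixed field of G_F^4[G_F^2,G_F] in the
   quadratic closure: the maximal finite Galois extension of F whose Galois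
   group satisfies the W-laws (every such extension F-embeds into L).
   Then Gal(L/F) is the W-group of F. *)
Definition W_closure (F : fieldType) (L : splittingFieldType F) : Prop :=
  [/\ galois 1%VS {:L}%VS,
      W_laws 'Gal({:L}%VS / 1%VS)%g
    & forall M : splittingFieldType F,
        galois 1%VS {:M}%VS -> W_laws 'Gal({:M}%VS / 1%VS)%g ->
        inhabited 'AHom(M, L)].

(* A cochain is a function on finite sequences of group elements; a k-cochain
   is only evaluated on sequences of length k with entries in G. *)
Definition cochain (gT : finGroupType) := seq gT -> 'F_2.

Definition on_G (gT : finGroupType) (G : {set gT}) (k : nat) (gs : seq gT) : Prop :=
  size gs = k /\ all (fun g => g \in G) gs.

Definition mul_at (gT : finGroupType) (i : nat) (gs : seq gT) : seq gT :=
  take i gs ++ (nth 1%g gs i * nth 1%g gs i.+1)%g :: drop i.+2 gs.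

Definition coboundary (gT : finGroupType) (k : nat) (f : cochain gT) : cochain gT :=
  fun gs => f (behead gs)
            + \sum_(i < k) (-1) ^+ i.+1 * f (mul_at i gs)
            + (-1) ^+ k.+1 * f (take k gs).

Definition is_cocycle (gT : finGroupType) (G : {set gT}) (k : nat) (f : cochain gT) : Prop :=
  forall gs, on_G G k.+1 gs -> coboundary k f gs = 0.

Definition is_coboundary (gT : finGroupType) (G : {set gT}) (k : nat) (f : cochain gT) : Prop :=
  match k with
  | 0 => forall gs, on_G G 0 gs -> f gs = 0
  | m.+1 => exists h : cochain gT, forall gs, on_G G m.+1 gs -> f gs = coboundary m h gs
  end.

Definition cup (gT : finGroupType) (p : nat) (f f' : cochain gT) : cochain gT :=
  fun gs => f (take p gs) * f' (drop p gs).

Inductive H1_product (gT : finGroupType) (G : {set gT}) : nat -> cochain gT -> Prop :=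
  | H1p0 : H1_product G 0 (fun _ => 1)
  | H1pS k a f : is_cocycle G 1 a -> H1_product G k f ->
                 H1_product G k.+1 (cup 1 a f).

(* f is a degree-k cochain representing an element of the degree-k part of
   the subring R of H^*(G,F_2) generated by H^1(G,F_2): a sum of k-fold cup
   products of 1-cocycles. *)
Definition in_R_deg (gT : finGroupType) (G : {set gT}) (k : nat) (f : cochain gT) : Prop :=
  exists s : seq (cochain gT),
    (forall i, (i < size s)%N -> H1_product G k (nth (fun _ => 0) s i)) /\
    (forall gs, on_G G k gs -> f gs = \sum_(a <- s) a gs).

Definition c_le (gT : finGroupType) (G : {set gT}) (n : nat) : Prop :=
  forall k, (n < k)%N -> forall f : cochain gT, in_R_deg G k f -> is_coboundary G k f.

(* Main.v *)
Require Import Defs.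
From HB Require Import structures.
From mathcomp Require Import all_boot all_order all_algebra all_fingroup all_field.
From mathcomp Require Import ring.
From Stdlib Require Import Classical.
Set Implicit Arguments. Unset Strict Implicit. Unset Printing Implicit Defensive.
Import GRing.Theory.
Local Open Scope ring_scope.

(* Every degree-1 class is the Kummer character {b} of some b in F^x, and the
   cup products satisfy the relations of Milnor K-theory mod 2; the Steinberg
   relation {a}{1 - a} = 0 holds because sqrt (1 + sqrt a) generates an extension
   obeying the W-laws, hence contained in L.  Given a symbol {a_k}...{a_1}, let
   A_i be the subgroup of those b with {b}{a_i}...{a_1} = 0; then A_i is contained
   in A_(i+1).  If each of these inclusions is strict for i < n, then A_n contains
   2^n square classes, so all of F^x.  If A_(i+1) = A_i, put a = a_(i+1): then A_i
   contains -a, it is closed under addition by the Steinberg relation, and so it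
   contains the sum of squares -1 and hence a.  Either way every symbol of length
   n + 1 vanishes. *)

(** * Vanishing of symbols from the formal Milnor relations *)

Section SymbolVanishing.

(** [Z s] stands for the vanishing of the symbol with entries [s]; the hypotheses are the relations
    of Milnor K-theory mod 2. *)
Variables (F : fieldType) (Z : seq F -> Prop).

Hypothesis Z_cons : forall a s, Z s -> Z (a :: s).
Hypothesis Z_mul : forall a b s, a != 0 -> b != 0 ->
  Z (a :: s) -> Z (b :: s) -> Z (a * b :: s).
Hypothesis Z_swap : forall a b s, Z (a :: b :: s) -> Z (b :: a :: s).
Hypothesis Z_sqr : forall c s, c != 0 -> Z (c ^+ 2 :: s).
Hypothesis Z_steinberg : forall a b s, a != 0 -> b != 0 -> a + b = 1 ->
  Z (a :: b :: s).

Let Z_inv a s : a != 0 -> Z (a :: s) -> Z (a^-1 :: s).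
Proof.
move=> a0 Za; have -> : a^-1 = a * a^-1 ^+ 2 by rewrite expr2 mulVKf.
by apply: Z_mul; rewrite ?expf_neq0 ?invr_neq0 //; apply: Z_sqr; rewrite invr_neq0.
Qed.

Let Z_mul2 c a b s : a != 0 -> b != 0 ->
  Z (c :: a :: s) -> Z (c :: b :: s) -> Z (c :: a * b :: s).
Proof. by move=> a0 b0 Za Zb; apply/Z_swap/Z_mul => //; apply: Z_swap. Qed.

(** Writes [- a] as [(1 - a) / (1 - a^-1)] and applies the Steinberg relation to [a] and to [a^-1];
    at [a = 1] both differences vanish, but then [a] is a square. *)
Let Z_opp a s : a != 0 -> Z (- a :: a :: s).
Proof.
move=> a0; have [->|a1] := eqVneq a 1.
  by apply: Z_cons; rewrite -(expr1n _ 2); apply/Z_sqr/oner_neq0.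
have d0 : 1 - a != 0 by rewrite subr_eq0 eq_sym.
have d0' : 1 - a^-1 != 0 by rewrite subr_eq0 eq_sym invr_eq1.
have -> : - a = (1 - a) * (1 - a^-1)^-1.
  by apply: (canRL (mulfK d0')); rewrite mulrBr mulr1 mulNr mulfV // opprK addrC.
apply: Z_mul => //; rewrite ?invr_neq0 //; first by apply: Z_steinberg; rewrite ?subrK.
apply: Z_swap; rewrite -[a]invrK; apply: Z_inv; rewrite ?invr_neq0 //.
apply/Z_swap/Z_inv; rewrite invrK //.
by apply: Z_steinberg; rewrite ?invr_neq0 ?subrK.
Qed.

(* Kneser's argument, with the value set of a Pfister form replaced by the
   annihilator of the symbol s. *)
Let Z_stationary a s : a != 0 -> ~ formally_real F ->
    (forall b, b != 0 -> Z (b :: a :: s) -> Z (b :: s)) -> Z (a :: s).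
Proof.
move=> a0 nreal stat.
have Na0 : - a != 0 by rewrite oppr_eq0.
have ZNa : Z (- a :: s) by apply: stat => //; apply: Z_opp.
have Z_add1 y : y != 0 -> 1 + y != 0 -> Z (y :: s) -> Z (1 + y :: s).
  move=> y0 y1 Zy; apply: stat => //.
  (* Splits {1 + y}{a} into {1 + y}{-a}, {1 + y}{-y} and {1 + y}{y^-1}: the outer two vanish because
     [- a] and [y] annihilate [s], the middle one is Steinberg. *)
  have -> : a = - a * (- y * y^-1) by field.
  apply: Z_mul2; rewrite ?mulf_neq0 ?oppr_eq0 ?invr_eq0 //; first exact: Z_cons.
  apply: Z_mul2; rewrite ?oppr_eq0 ?invr_eq0 //; last exact/Z_cons/Z_inv.
  by apply/Z_steinberg; rewrite ?oppr_eq0 // addrK.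
have Z_add x y : x != 0 -> y != 0 -> x + y != 0 ->
    Z (x :: s) -> Z (y :: s) -> Z (x + y :: s).
  move=> x0 y0 xy0 Zx Zy.
  have E : x + y = x * (1 + y / x) by rewrite mulrDr mulr1 mulrCA mulfV // mulr1.
  move: (xy0); rewrite {1}E mulf_eq0 negb_or => /andP[_ z0]; rewrite E.
  have yx0 : y / x != 0 by rewrite mulf_neq0 ?invr_eq0.
  apply: Z_mul => //; apply: Z_add1 => //.
  by apply: Z_mul; rewrite ?invr_eq0 //; apply: Z_inv.
have Z_sum (r : seq F) : let t := \sum_(x <- r) x ^+ 2 in t = 0 \/ Z (t :: s).
  elim: r => [|x r IH] /=; first by rewrite big_nil; left.
  rewrite big_cons; move: IH; set t := \sum_(_ <- _) _.
  have [-> _|t0 [t0'|Zt]] := eqVneq t 0; last 2 first.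
  - by rewrite t0' eqxx in t0.
  - have [->|x0] := eqVneq x 0; first by rewrite expr0n add0r; right.
    have [|xt0] := eqVneq (x ^+ 2 + t) 0; first by left.
    by right; apply: Z_add => //; [rewrite expf_neq0 | apply: Z_sqr].
  rewrite addr0; have [->|x0] := eqVneq x 0; first by rewrite expr0n; left.
  by right; apply: Z_sqr.
have [r Er] := NNPP _ nreal.
have N1 : (-1 : F) != 0 by rewrite oppr_eq0 oner_eq0.
have := Z_sum r; rewrite /= -Er => -[E|Z1]; first by rewrite E eqxx in N1.
by rewrite -[a]opprK -mulN1r; apply: Z_mul.
Qed.

(** The annihilator doubles at each new entry [a]: an [x] that kills [a :: s] but not [s] adds the
    coset of all [x * t i] to the old family. If there is no such [x], the symbol vanishes by
    [Z_stationary]. *)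
Let chain (s : seq F) : ~ formally_real F -> all (fun x => x != 0) s ->
  Z s \/ exists (I : finType) (t : I -> F),
    [/\ #|I| = (2 ^ size s)%N, forall i, t i != 0, forall i, Z (t i :: s)
      & forall i j, is_square (t i / t j) -> i = j].
Proof.
move=> nreal; elim: s => [_|a s IH] /=.
  right; exists unit, (fun=> 1); split=> [|_|_|[] []] //; first by rewrite card_unit.
    exact: oner_neq0.
  by rewrite -(expr1n _ 2); apply/Z_sqr/oner_neq0.
case/andP=> a0 /IH[Zs|[I [t [cI t0 Zt injt]]]]; first by left; apply: Z_cons.
have up b : Z (b :: s) -> Z (b :: a :: s) by move=> Zb; apply/Z_swap/Z_cons.
have [[x [x0 Zx nZx]]|nex] :=
    classic (exists x, [/\ x != 0, Z (x :: a :: s) & ~ Z (x :: s)]); last first.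
  left; apply: Z_stationary => // b b0 Zb; apply: NNPP => nZb.
  by apply: nex; exists b.
right; exists (bool * I)%type, (fun p => (if p.1 then x else 1) * t p.2).
split=> [|[e i]|[e i]|[e i] [e' j]] /=.
- by rewrite card_prod card_bool cI expnS.
- by case: e; rewrite ?mul1r ?mulf_neq0.
- by case: e; rewrite ?mul1r; last exact: up; apply: Z_mul => //; apply: up.
(* Otherwise [x] would be a product of a square, [t l] and the inverse of [t k], all of which
   annihilate [s]. *)
have noclass k l : ~ is_square (x * t k / t l).
  case=> c Ec; apply: nZx.
  have c0 : c != 0.
    apply/eqP=> c0; move/eqP: Ec; rewrite c0 expr0n /= !mulf_eq0 invr_eq0.
    by rewrite (negPf x0) !(negPf (t0 _)).
  have -> : x = c ^+ 2 * (t l * (t k)^-1).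
    by rewrite -Ec mulrA mulfVK // mulfK.
  apply: Z_mul; rewrite ?mulf_neq0 ?invr_eq0 ?expf_neq0 //; first exact: Z_sqr.
  by apply: Z_mul; rewrite ?invr_eq0 //; apply: Z_inv.
case: e e' => [] [] /=.
- by rewrite -mulf_div mulfV // mul1r => /injt->.
- by rewrite mul1r => /noclass.
- rewrite mul1r => -[c Ec]; case: (noclass j i); exists c^-1.
  by rewrite exprVn -Ec invf_div.
- by rewrite !mul1r => /injt->.
Qed.

Lemma symbol_vanish (n : nat) (s : seq F) :
    ~ formally_real F -> square_class_card F (2 ^ n) ->
    (n < size s)%N -> all (fun x => x != 0) s -> Z s.
Proof.
move=> nreal [f [f0 injf surjf]].
elim: s => [//|a s IH] /= szs /andP[a0 s0].
have [lt_s|le_s] := ltnP n (size s); first by apply/Z_cons/IH.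
have {szs IH le_s} sz : size s = n by apply/eqP; rewrite eqn_leq le_s -ltnS.
have [Zs|[I [t [cI t0 Zt injt]]]] := chain nreal s0; first exact: Z_cons.
(* Counting: the [2 ^ n] inequivalent [t i] represent every square class, in particular that of
   [a]. *)
have [g tg] := fin_all_exists (fun i => surjf _ (t0 i)).
have g_inj : injective g.
  move=> i j gij; apply: injt.
  have [[c Ec] [d Ed]] := (tg i, tg j); exists (c / d).
  by rewrite expr_div_n -Ec -Ed gij invf_div mulrA mulfVK ?f0.
have [k ak] := surjf a a0.
have /codomP[i Ei] : k \in codom g.
  by apply: inj_card_onto; rewrite // cI sz card_ord.
have [[c Ec] [d Ed]] := (ak, tg i).
have Ea : a = t i * (c / d) ^+ 2.
  by rewrite expr_div_n -Ec -Ed Ei; field; rewrite ?f0 ?t0.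
have cd0 : c / d != 0.
  by apply: contraNneq a0 => cd; rewrite Ea cd expr0n mulr0.
by rewrite Ea; apply: Z_mul; rewrite ?expf_neq0 //; apply: Z_sqr.
Qed.

End SymbolVanishing.

(** * Biquadratic equations and the maximality of the W-closure *)

Lemma sqr_eq_sign (K : idomainType) (x y : K) :
  x ^+ 2 = y ^+ 2 -> exists e : bool, x = (-1) ^+ e * y.
Proof.
move/eqP; rewrite eqf_sqr => /orP[]/eqP->; first by exists false; rewrite mul1r.
by exists true; rewrite mulN1r.
Qed.

(** The quadratic extension is built over [L] and then regarded over [F]; [f] is only a ring
    morphism, so its compatibility with scalars is recorded apart. *)
Lemma sqrt_adjoin (F : fieldType) (L : fieldExtType F) (c : L) :
  exists (E : fieldExtType F) (f : {rmorphism L -> E}) (w : E),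
    (forall k : F, f k%:A = k%:A) /\ w ^+ 2 = f c.
Proof.
have [[y y2]|noroot] := classic (exists y : L, y ^+ 2 = c).
  by exists L, idfun, y.
have irr : irreducible_poly ('X^2 - c%:P).
  apply: cubic_irreducible; first by rewrite size_XnsubC.
  move=> x; apply/negP => /rootP/eqP; rewrite !hornerE subr_eq0 => /eqP x2.
  by apply: noroot; exists x.
have [L' _ [w rw _]] := irredp_FAdjoin irr.
exists (baseFieldType L'), (in_alg L'), w; split.
  by move=> k; rewrite -[RHS]baseField_scaleE.
move/rootP/eqP: rw; rewrite rmorphB /= map_polyXn map_polyC !hornerE.
by rewrite subr_eq0 => /eqP.
Qed.

Lemma gal_fix_scalar (F : fieldType) (M : splittingFieldType F)
  (g : gal_of {:M}) (x : M) : x \in 1%VS -> g x = x.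
Proof. by case/vlineP=> k ->; rewrite linearZ rmorph1. Qed.

(** The roots of X^4 - (u^2 + v^2) X^2 + u^2 v^2 are u, -u, v, -v, so an automorphism permutes [u]
    and [v] up to signs, as in the dihedral group of order 8. *)
Lemma W_laws_biquadratic (F : fieldType) (M : splittingFieldType F) (u v : M) :
    u ^+ 2 + v ^+ 2 \in 1%VS -> u ^+ 2 * v ^+ 2 \in 1%VS ->
    <<1 & [:: u; v]>>%VS = {:M}%VS ->
  W_laws 'Gal({:M} / 1)%g.
Proof.
move=> sF tF genM.
have ext (g h : gal_of {:M}) : g u = h u -> g v = h v -> g = h.
  move=> gu gv; apply/eqP/gal_eqP => x _.
  have Mx : x \in <<1 & [:: u; v]>>%VS by rewrite genM memvf.
  have hK y : (h^-1)%g (h y) = y by rewrite -galM ?memvf // mulgV gal_id.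
  have hK' y : h ((h^-1)%g y) = y by rewrite -galM ?memvf // mulVg gal_id.
  have sub : (<<1 & [:: u; v]>> <= fixedSpace (g * h^-1)%g)%VS.
    apply/Fadjoin_seqP; split; first exact: sub1v.
    by move=> z /[!inE] /orP[]/eqP->; apply/fixedSpaceP;
      rewrite galM ?memvf // ?gu ?gv hK.
  have /fixedSpaceP := subvP sub x Mx; rewrite galM ?memvf // => /(congr1 h).
  by rewrite hK'.
have act (g : gal_of {:M}) : exists e e' : bool,
    (g u = (-1) ^+ e * u /\ g v = (-1) ^+ e' * v) \/
    (g u = (-1) ^+ e * v /\ g v = (-1) ^+ e' * u).
  have := gal_fix_scalar g sF; have := gal_fix_scalar g tF.
  rewrite rmorphM rmorphD !rmorphXn /= => gt gs.
  have : (g u ^+ 2 - u ^+ 2) * (g u ^+ 2 - v ^+ 2) == 0.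
    have -> : (g u ^+ 2 - u ^+ 2) * (g u ^+ 2 - v ^+ 2) =
        g u ^+ 4 - g u ^+ 2 * (u ^+ 2 + v ^+ 2) + u ^+ 2 * v ^+ 2 by ring.
    by rewrite -gs -gt; apply/eqP; ring.
  rewrite mulf_eq0 !subr_eq0 => /orP[]/eqP gu.
    have gv : g v ^+ 2 = v ^+ 2 by apply: (addrI (u ^+ 2)); rewrite -gs gu.
    have [e ->] := sqr_eq_sign gu; have [e' ->] := sqr_eq_sign gv.
    by exists e, e'; left.
  have gv : g v ^+ 2 = u ^+ 2 by apply: (addrI (v ^+ 2)); rewrite -{1}gu gs addrC.
  have [e ->] := sqr_eq_sign gu; have [e' ->] := sqr_eq_sign gv.
  by exists e, e'; right.
have sgn (g : gal_of {:M}) (e : bool) x : g ((-1) ^+ e * x) = (-1) ^+ e * g x.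
  by rewrite rmorphM rmorphXn rmorphN rmorph1.
(* One sign [e] serves both generators, so a square acts on them as a scalar: it commutes with every
   [h], and its own square is trivial. *)
have sqr_act (g : gal_of {:M}) : exists e : bool,
    (g ^+ 2)%g u = (-1) ^+ e * u /\ (g ^+ 2)%g v = (-1) ^+ e * v.
  rewrite !galM ?memvf //; have [e [e' [[gu gv]|[gu gv]]]] := act g.
    exists false; rewrite gu gv !sgn gu gv.
    by rewrite !signrMK expr0 !mul1r.
  exists (e (+) e'); rewrite gu gv !sgn gu gv !mulrA -!signr_addb.
  by rewrite (addbC e' e).
have comm (g h : gal_of {:M}) : commute (g ^+ 2)%g h.
  have [e []] := sqr_act g; move: (g ^+ 2)%g => q gu gv.
  have [e1 [e2 [[hu hv]|[hu hv]]]] := act h;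
  by apply: ext; rewrite !galM ?memvf // ?hu ?hv ?gu ?gv !sgn ?hu ?hv ?gu ?gv //
     mulrCA.
move=> g h _ _; split; last exact: comm.
rewrite (expgM g 2 2); have [e []] := sqr_act g; move: (g ^+ 2)%g => q gu gv.
by apply: ext; rewrite gal_id (expgS q 1) expg1 galM ?memvf // ?gu ?gv sgn
  ?gu ?gv signrMK.
Qed.

(** [M] is the splitting field of (X^2 - u^2)(X^2 - v^2), whose roots are distinct, so it is Galois
    and the maximality of [L] applies. *)
Lemma W_closure_biquadratic (F : fieldType) (L : splittingFieldType F)
    (M : fieldExtType F) (u v : M) :
    W_closure L ->
    u ^+ 2 + v ^+ 2 \in 1%VS -> u ^+ 2 * v ^+ 2 \in 1%VS ->
    uniq [:: u; - u; v; - v] ->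
    <<1 & [:: u; v]>>%VS = {:M}%VS ->
  inhabited 'AHom(M, L).
Proof.
move=> [_ _ maxL] sF tF uq genM.
set p := \prod_(z <- [:: u; - u; v; - v]) ('X - z%:P).
have pF : p \is a polyOver 1%VS.
  have -> : p = 'X^4 - (u ^+ 2 + v ^+ 2)%:P * 'X^2 + (u ^+ 2 * v ^+ 2)%:P.
    by rewrite /p !big_cons big_nil; ring.
  by rewrite rpredD ?rpredB ?rpredM ?rpredX ?polyOverX ?polyOverC.
have spl : splittingFieldFor 1 p {:M}.
  exists [:: u; - u; v; - v]; first exact: eqpxx.
  apply/eqP; rewrite eqEsubv subvf /= -genM.
  apply/Fadjoin_seqP; split; first exact: subv_adjoin_seq.
  by move=> z /[!inE] /orP[]/eqP->; apply: seqv_sub_adjoin; rewrite !inE eqxx ?orbT.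
have ax : splitting_field_axiom M by exists p.
pose M' : splittingFieldType F := HB.pack M (FieldExt_isSplittingField.Build F M ax).
apply: (maxL M').
  by apply/splitting_galoisField; exists p; split=> //; rewrite separable_prod_XsubC.
exact: (@W_laws_biquadratic F M' u v).
Qed.

(** [M] may exceed F(u, v), so only that subfield is embedded in [L]. Stating the result through
    polynomials over [F] hides the subfield from later uses. *)
Lemma W_closure_root (F : fieldType) (L : splittingFieldType F)
    (M : fieldExtType F) (u v : M) :
    W_closure L ->
    u ^+ 2 + v ^+ 2 \in 1%VS -> u ^+ 2 * v ^+ 2 \in 1%VS ->
    uniq [:: u; - u; v; - v] ->
  exists u' : L, forall p : {poly F},
    root (map_poly (in_alg M) p) u -> root (map_poly (in_alg L) p) u'.
Proof.
move=> WL sF tF uq; pose K := <<1 & [:: u; v]>>%VS.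
have [Ku Kv] : u \in K /\ v \in K.
  by split; apply: seqv_sub_adjoin; rewrite !inE eqxx ?orbT.
pose u1 : subvs_of K := vsproj K u; pose v1 : subvs_of K := vsproj K v.
have u1E : vsval u1 = u by rewrite vsprojK.
have v1E : vsval v1 = v by rewrite vsprojK.
have val_scal k : val (k%:A : subvs_of K) = k%:A.
  have -> : val (k%:A : subvs_of K) = k *: algid K by [].
  by rewrite algid1.
have sc (x : subvs_of K) : vsval x \in 1%VS -> x \in 1%VS.
  case/vlineP=> k xk; apply/vlineP; exists k; apply: val_inj.
  by rewrite val_scal -xk.
have genK : <<1 & [:: u1; v1]>>%VS = {:subvs_of K}%VS.
  (* The inclusion into [M] maps F(u1, v1) onto [K]; since it is injective, F(u1, v1) is
     everything. *)
  pose toM := linfun (vsval : subvs_of K -> M).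
  apply/vspaceP => x; rewrite memvf.
  have : val x \in (toM @: <<1 & [:: u1; v1]>>)%VS.
    by rewrite aimg_adjoin_seq aimg1 /= !lfunE /= u1E v1E (valP x).
  by case/memv_imgP=> y Ky; rewrite lfunE => /val_inj->.
have [|||//|h] := @W_closure_biquadratic F L (subvs_of K) u1 v1 WL.
- by apply: sc; rewrite rmorphD !rmorphXn /= u1E v1E.
- by apply: sc; rewrite rmorphM !rmorphXn /= u1E v1E.
- by rewrite -(map_inj_uniq val_inj) /= !vsprojK.
exists (h u1) => p.
have -> : map_poly (in_alg L) p = map_poly h (map_poly (in_alg (subvs_of K)) p).
  by rewrite -map_poly_comp; apply: eq_map_poly => k /=; rewrite linearZ rmorph1.
have -> : map_poly (in_alg M) p =
    map_poly (vsval : subvs_of K -> M) (map_poly (in_alg (subvs_of K)) p).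
  by rewrite -map_poly_comp; apply: eq_map_poly => k; apply/esym/val_scal.
set q := map_poly _ p; rewrite fmorph_root => ru.
have down (x : M) : x = vsval u1 -> root (map_poly (vsval : subvs_of K -> M) q) x ->
  root q u1 by move=> ->; rewrite fmorph_root.
exact: down (esym u1E) ru.
Qed.

(** * Cochain calculus over the field with two elements *)

Lemma F2_N1 : (-1 : 'F_2) = 1.
Proof. exact: val_inj. Qed.

Lemma F2_addxx (x : 'F_2) : x + x = 0.
Proof. by apply: val_inj; case: x => [] [|[|]]. Qed.

Lemma F2_add3_eq0 (x y z : 'F_2) : x + y + z = 0 -> x = y + z.
Proof.
move=> E; rewrite -[LHS]addr0 -(F2_addxx (y + z)) addrA.
by rewrite [x + _]addrA E add0r.
Qed.

(** Commutativity of the cup product, for the values of two 1-cocycles at g0 and g1: the parenthesis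
    is the coboundary of their pointwise product. *)
Lemma F2_polar (a0 a1 b0 b1 : 'F_2) :
  a0 * b1 + (a1 * b1 + (a0 + a1) * (b0 + b1) + a0 * b0) = b0 * a1.
Proof.
by rewrite -[RHS]addr0 -(F2_addxx (a0 * b1 + a1 * b1 + a0 * b0)); ring.
Qed.

Lemma F2_addb (e e' : bool) : (e (+) e')%:R = e%:R + e'%:R :> 'F_2.
Proof. by case: e e' => [] []; apply: val_inj. Qed.

Section Cochains.

Variables (gT : finGroupType) (G : {group gT}).
Implicit Types (f h : cochain gT) (t gs : seq gT) (g : gT).

Lemma cup1_cons f h g t : cup 1 f h (g :: t) = f [:: g] * h t.
Proof. by rewrite /cup /= take0 drop0. Qed.

Lemma coboundaryE m f gs :
  coboundary m f gs = f (behead gs) + \sum_(i < m) f (mul_at i gs) + f (take m gs).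
Proof.
rewrite /coboundary F2_N1 expr1n mul1r; congr (_ + _ + _).
by apply: eq_bigr => i _; rewrite expr1n mul1r.
Qed.

Lemma coboundary1 f g0 g1 :
  coboundary 1 f [:: g0; g1] = f [:: g1] + f [:: (g0 * g1)%g] + f [:: g0].
Proof. by rewrite coboundaryE big_ord1. Qed.

(** The Leibniz rule for a left factor of degree 1. The term [f [:: g0] * h t] occurs in both
    summands on the right and cancels mod 2. *)
Lemma coboundary_cup1 m f h g0 g1 t :
  coboundary m.+1 (cup 1 f h) [:: g0, g1 & t] =
  coboundary 1 f [:: g0; g1] * h t + f [:: g0] * coboundary m h (g1 :: t).
Proof.
have E0 : cup 1 f h (mul_at 0 [:: g0, g1 & t]) = f [:: (g0 * g1)%g] * h t.
  by rewrite /mul_at /= drop0 cup1_cons.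
have ES (i : 'I_m) : cup 1 f h (mul_at i.+1 [:: g0, g1 & t]) =
    f [:: g0] * h (mul_at i (g1 :: t)).
  exact: cup1_cons.
rewrite coboundary1 !coboundaryE big_ord_recl E0.
under eq_bigr => i _ do rewrite ES.
rewrite [take _ _]/= [behead _]/= !cup1_cons.
rewrite -mulr_sumr; set S := \sum_(_ < _) _.
rewrite -[LHS]addr0 -(F2_addxx (f [:: g0] * h t)); ring.
Qed.

Lemma on_G_cons k g t : on_G G k.+1 (g :: t) <-> g \in G /\ on_G G k t.
Proof.
by rewrite /on_G /=; split=> [[[->] /andP[-> ->]]|[-> [-> ->]]].
Qed.

Lemma on_G_S k gs : on_G G k.+1 gs -> exists g t, [/\ gs = g :: t, g \in G & on_G G k t].
Proof. by case: gs => [[]//|g t] /on_G_cons[]; exists g, t. Qed.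

Lemma is_coboundary_ext k f h :
  (forall gs, on_G G k gs -> f gs = h gs) -> is_coboundary G k f -> is_coboundary G k h.
Proof.
case: k => [|k] fh /=; first by move=> f0 gs Ggs; rewrite -fh ?f0.
by case=> c fc; exists c => gs Ggs; rewrite -fh ?fc.
Qed.

Lemma is_coboundary0 k : is_coboundary G k (fun=> 0).
Proof.
case: k => [|k] //=; exists (fun=> 0) => gs _.
by rewrite coboundaryE big1 // !addr0.
Qed.

Lemma is_coboundaryD k f h : is_coboundary G k f -> is_coboundary G k h ->
  is_coboundary G k (fun gs => f gs + h gs).
Proof.
case: k => [|k] /=; first by move=> f0 h0 gs Ggs; rewrite f0 ?h0 ?addr0.
case=> c fc [d hd]; exists (fun gs => c gs + d gs) => gs Ggs.
by rewrite fc ?hd // !coboundaryE big_split /= addrACA; congr (_ + _); rewrite addrACA.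
Qed.

Lemma cocycle1M f g0 g1 : is_cocycle G 1 f -> g0 \in G -> g1 \in G ->
  f [:: (g0 * g1)%g] = f [:: g0] + f [:: g1].
Proof.
move=> cf G0 G1; have : coboundary 1 f [:: g0; g1] = 0.
  by apply: cf; split; rewrite //= G0 G1.
rewrite coboundary1 [f [:: g1] + _]addrC => /F2_add3_eq0->.
by rewrite addrC.
Qed.

Lemma is_coboundary_cup1 k f h : is_cocycle G 1 f ->
  is_coboundary G k h -> is_coboundary G k.+1 (cup 1 f h).
Proof.
move=> cf; case: k => [h0|k [c hc]].
  apply: is_coboundary_ext (is_coboundary0 1) => gs /on_G_S[g [t [-> _ Gt]]].
  by rewrite cup1_cons h0 ?mulr0.
exists (cup 1 f c) => gs /on_G_S[g0 [t0 [-> G0]]] Gt0.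
have [g1 [t [Et G1 Gt]]] := on_G_S Gt0.
have G2 : on_G G 2 [:: g0; g1] by rewrite /on_G /= G0 G1.
by rewrite Et coboundary_cup1 cf // mul0r add0r cup1_cons hc -?Et.
Qed.

(** As [h] is a cocycle, the Leibniz rule leaves only its first term. Suitable choices of [f] give
    both commutativity and the Steinberg relation. *)
Lemma is_coboundary_cup2 k f h : is_cocycle G k h ->
  is_coboundary G k.+2
    (fun gs => coboundary 1 f (take 2 gs) * h (drop 2 gs)).
Proof.
move=> ch; exists (cup 1 f h) => gs /on_G_S[g0 [t0 [-> G0]]] /on_G_S[g1 [t [-> G1 Gt]]].
rewrite coboundary_cup1 ch ?mulr0 ?addr0 /= ?take0 ?drop0 //.
exact/on_G_cons.
Qed.

Lemma is_cocycle_cup1 k f h : is_cocycle G 1 f -> is_cocycle G k h ->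
  is_cocycle G k.+1 (cup 1 f h).
Proof.
move=> cf ch gs /on_G_S[g0 [t0 [-> G0]]] /on_G_S[g1 [t [-> G1 Gt]]].
have G2 : on_G G 2 [:: g0; g1] by rewrite /on_G /= G0 G1.
by rewrite coboundary_cup1 cf // mul0r add0r ch ?mulr0 //; apply/on_G_cons.
Qed.

Lemma is_coboundary_sum k (s : seq (cochain gT)) :
    (forall i, (i < size s)%N -> is_coboundary G k (nth (fun=> 0) s i)) ->
  is_coboundary G k (fun gs => \sum_(a <- s) a gs).
Proof.
elim: s => [|a s IH] Hs.
  by apply: is_coboundary_ext (is_coboundary0 k) => gs _; rewrite big_nil.
apply: is_coboundary_ext (is_coboundaryD (Hs 0 isT) (IH (fun i => Hs i.+1))) => gs _.
by rewrite big_cons.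
Qed.

End Cochains.

(** * Square roots inside the W-closure *)

Lemma uniq_opp_pair (K : fieldType) (u v : K) :
    (2%:R : K) != 0 -> u != 0 -> v != 0 -> u ^+ 2 != v ^+ 2 ->
  uniq [:: u; - u; v; - v].
Proof.
move=> two u0 v0; rewrite eqf_sqr negb_or => /andP[uv uNv].
have neqN (x : K) : x != 0 -> x != - x.
  by move=> x0; rewrite -addr_eq0 -mulr2n -mulr_natl mulf_neq0.
by rewrite /= !inE !negb_or !neqN // uv uNv eqr_oppLR uNv eqr_opp uv.
Qed.

Section WClosure.

Variables (F : fieldType) (L : splittingFieldType F).
Hypothesis two : (2%:R : F) != 0.
Hypothesis WL : W_closure L.

Let two_ext (E : fieldExtType F) : (2%:R : E) != 0.
Proof. by rewrite -(rmorph_nat (in_alg E)) fmorph_eq0. Qed.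

Let alg_eq0 (E : fieldExtType F) (k : F) : (k%:A == 0 :> E) = (k == 0).
Proof. exact: (fmorph_eq0 (in_alg E)). Qed.

(** Applies [W_closure_root] to a square root of [b] and to 1; with their opposites they are four
    distinct elements unless [b] is 0 or 1. *)
Lemma W_closure_sqrt (b : F) : exists y : L, y ^+ 2 = b%:A.
Proof.
have [->|b0] := eqVneq b 0; first by exists 0; rewrite expr0n scale0r.
have [->|b1] := eqVneq b 1; first by exists 1; rewrite expr1n scale1r.
have [E [f [w [fA w2]]]] := sqrt_adjoin (b%:A : L); rewrite fA in w2.
have w0 : w != 0.
  by apply: contraNneq b0 => w0; move/esym/eqP: w2; rewrite w0 expr0n alg_eq0.
have [|||y /(_ ('X^2 - b%:P))] := @W_closure_root F L E w 1 WL.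
- by rewrite w2 expr1n rpredD ?rpred1 // rpredZ ?rpred1.
- by rewrite w2 expr1n mulr1 rpredZ ?rpred1.
- apply: uniq_opp_pair; rewrite ?oner_eq0 ?two_ext //.
  by rewrite w2 expr1n (fmorph_eq1 (in_alg E)).
rewrite !rmorphB /= !map_polyXn !map_polyC /root !hornerE w2 subrr eqxx => /(_ isT).
by rewrite subr_eq0 => /eqP; exists y.
Qed.

(* When a + b = 1, the element 1 + sqrt a has norm b over F, so adjoining its
   square root to F(sqrt a, sqrt b) gives a group inside the dihedral group of
   order 8. *)
Lemma W_closure_dihedral (a b : F) : a != 0 -> b != 0 -> a + b = 1 ->
  exists x u v : L, [/\ x ^+ 2 = a%:A, u ^+ 2 = 1 + x, v ^+ 2 = 1 - x
    & (u * v) ^+ 2 = b%:A].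
Proof.
move=> a0 b0 ab1.
have abA (E : fieldExtType F) : 1 - a%:A = b%:A :> E.
  by apply/eqP; rewrite subr_eq -scalerDl addrC ab1 scale1r.
have nzA (E : fieldExtType F) k : k != 0 -> k%:A != 0 :> E by rewrite alg_eq0.
have [x x2] := W_closure_sqrt a; have [y y2] := W_closure_sqrt b.
have [E [f [w [fA w2]]]] := sqrt_adjoin (1 + x : L).
have fx2 : f x ^+ 2 = a%:A by rewrite -rmorphXn x2 fA.
have fy2 : f y ^+ 2 = b%:A by rewrite -rmorphXn y2 fA.
rewrite rmorphD rmorph1 in w2.
have E_ab : (1 + f x) * (1 - f x) = b%:A by rewrite -abA -fx2; ring.
have w20 : 1 + f x != 0.
  by apply: contraNneq (nzA E b b0) => w0; rewrite -E_ab w0 mul0r.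
have w0 : w != 0 by apply: contraNneq w20 => w0; rewrite -w2 w0 expr0n.
(* The second generator is a square root of 1 - sqrt a, because (1 + sqrt a)(1 - sqrt a) = b. *)
have v2 : (f y / w) ^+ 2 = 1 - f x.
  by rewrite expr_div_n fy2 w2 -E_ab mulrAC mulfV ?mul1r.
have [|||u ru] := @W_closure_root F L E w (f y / w) WL.
- by rewrite w2 v2 addrACA addrN addr0 rpredD ?rpred1.
- by rewrite w2 v2 E_ab rpredZ ?rpred1.
- apply: uniq_opp_pair; rewrite ?two_ext // ?w2 ?v2.
    rewrite mulf_neq0 ?invr_eq0 // -sqrf_eq0 fy2; exact: nzA.
  rewrite -subr_eq0 opprB addrC addrA subrK -mulr2n -mulr_natl.
  by rewrite mulf_neq0 ?two_ext // -sqrf_eq0 fx2 nzA.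
have {ru} /(_ (('X^2 - 1) ^+ 2 - a%:P)) := ru.
rewrite !rmorphB !rmorphXn /= !rmorphB /= !rmorph1 !map_polyXn !map_polyC /root !hornerE.
rewrite w2 [1 + _]addrC addrK fx2 subrr eqxx => /(_ isT); rewrite subr_eq0 => /eqP.
rewrite -[X in _ = X]/(a%:A) => u4.
have u0 : u != 0.
  apply: contraNneq (nzA L b b0) => u0.
  by rewrite -abA -u4 u0 expr0n sub0r sqrrN expr1n subrr.
(* The earlier [x] may differ in sign from [u ^+ 2 - 1], so the latter is the witness. *)
exists (u ^+ 2 - 1), u, (y / u); split=> //.
- by rewrite [RHS]addrC subrK.
- rewrite expr_div_n y2 -abA -u4; apply: (canLR (mulfK _)); last by ring.
  by rewrite expf_neq0.
- by rewrite mulrC divfK.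
Qed.

(** * Kummer characters of the W-group *)

Let G := 'Gal({:L} / 1)%G.
Implicit Types (g h : gal_of {:L}) (y z : L).

(** Meant for nonzero [y] with [y ^+ 2] in [F]: then [g y] is [y] or [- y], and the boolean is the
    exponent of the sign. *)
Definition sqrt_sign g y : bool := g y != y.

Definition chi y : cochain (gal_of {:L}) := fun gs => (sqrt_sign (head 1%g gs) y)%:R.

Lemma sqrt_signP g y (e : bool) : y != 0 ->
  g y = (-1) ^+ e * y -> sqrt_sign g y = e.
Proof.
move=> y0; rewrite /sqrt_sign => ->; case: e; last by rewrite mul1r eqxx.
by rewrite mulN1r eq_sym -addr_eq0 -mulr2n -mulr_natl mulf_neq0 ?two_ext.
Qed.

Lemma sqrt_signE g y : y ^+ 2 \in 1%VS -> g y = (-1) ^+ sqrt_sign g y * y.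
Proof.
move=> /(gal_fix_scalar g); rewrite rmorphXn /= /sqrt_sign => /sqr_eq_sign[[] gy].
  by rewrite gy; case: eqP => [->|_]; rewrite ?mul1r //.
by rewrite gy !mul1r eqxx mul1r.
Qed.

Lemma gal_sign g (e : bool) y : g ((-1) ^+ e * y) = (-1) ^+ e * g y.
Proof. by rewrite rmorphM rmorphXn rmorphN rmorph1. Qed.

Lemma sqrt_signM g y z : y != 0 -> z != 0 -> y ^+ 2 \in 1%VS -> z ^+ 2 \in 1%VS ->
  sqrt_sign g (y * z) = sqrt_sign g y (+) sqrt_sign g z.
Proof.
move=> y0 z0 y2 z2; apply: sqrt_signP; first by rewrite mulf_neq0.
by rewrite rmorphM /= (sqrt_signE g y2) (sqrt_signE g z2) signr_addb mulrACA.
Qed.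

Lemma sqrt_sign_galM g h y : y != 0 -> y ^+ 2 \in 1%VS ->
  sqrt_sign (g * h)%g y = sqrt_sign g y (+) sqrt_sign h y.
Proof.
move=> y0 y2; apply: sqrt_signP => //.
by rewrite galM ?memvf // (sqrt_signE g y2) gal_sign (sqrt_signE h y2) signr_addb mulrA.
Qed.

(** Two square roots of one element differ by a sign, which [g] fixes; the character thus depends on
    the square alone. *)
Lemma sqrt_sign_sqr g y z : y ^+ 2 = z ^+ 2 -> sqrt_sign g y = sqrt_sign g z.
Proof.
move=> /sqr_eq_sign[e ->]; rewrite /sqrt_sign gal_sign.
by rewrite (inj_eq (mulfI _)) // signr_eq0.
Qed.

Lemma chi_cocycle y : y != 0 -> y ^+ 2 \in 1%VS -> is_cocycle G 1 (chi y).
Proof.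
move=> y0 y2 gs /on_G_S[g0 [t0 [-> _]]] /on_G_S[g1 [t [-> _ []]]].
case: t => // _ _; rewrite coboundary1 /chi /=.
by rewrite sqrt_sign_galM // F2_addb addrCA F2_addxx addr0 F2_addxx.
Qed.

(* Kummer theory: the Lagrange resolvent of the character (-1)^f. *)
Lemma cocycle1_chi f : is_cocycle G 1 f ->
  exists (b : F) (y : L), [/\ b != 0, y ^+ 2 = b%:A
    & forall g, g \in G -> f [:: g] = chi y [:: g]].
Proof.
move=> cf; pose e g : bool := f [:: g] != 0; pose c g : L := (-1) ^+ e g.
have fe g : f [:: g] = (e g)%:R.
  by rewrite /e; case: (f [:: g]) => [[|[|]]] // i; apply: val_inj.
have eM g h : g \in G -> h \in G -> e (g * h)%g = e g (+) e h.
  move=> Gg Gh; have := cocycle1M cf Gg Gh; rewrite !fe -F2_addb.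
  by move=> /(congr1 val); case: (e _) (_ (+) _) => [] [].
have c1 : c 1%g != 0 by rewrite signr_eq0.
(* Independence of automorphisms yields a [w] whose resolvent [d] is nonzero. *)
have [w _] := gal_independent_contra (P := [in G]) (c_ := c) (group1 G) c1.
set d := \sum_(_ in _) _ => d0.
have gd g : g \in G -> g d = (-1) ^+ e g * d.
  move=> Gg; rewrite /d rmorph_sum mulr_sumr [RHS](reindex_inj (mulIg g)).
  apply: eq_big => [h|h Gh]; first by rewrite /= groupMr.
  rewrite /c /= gal_sign galM ?memvf // eM // signr_addb -mulrA [RHS]mulrCA.
  by rewrite signrMK.
have dF : d ^+ 2 \in 1%VS.
  have [gal1 _ _] := WL; have <- := galois_fixedField gal1.
  apply/fixedFieldP; first exact: memvf.
  by move=> g Gg; rewrite rmorphXn /= gd // exprMn sqrr_sign mul1r.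
have [b db] := vlineP _ _ dF; exists b, d; split=> //.
  by apply: contraNneq d0 => b0; rewrite -sqrf_eq0 db b0 scale0r.
move=> g Gg; rewrite fe /chi /=; congr (_%:R).
by rewrite (sqrt_signP d0 (gd g Gg)).
Qed.

(** Each [g] sends [u] to (-1)^(e g) times [u] or [v]. The exponent [e] fails to be additive exactly
    when [g0] exchanges [u] and [v] up to sign and [g1] changes the sign of [u * v]; this defect is
    the cup product. *)
Lemma dihedral_cup (x u v : L) : u != 0 -> v != 0 -> x != 0 ->
    u ^+ 2 = 1 + x -> v ^+ 2 = 1 - x -> x ^+ 2 \in 1%VS -> (u * v) ^+ 2 \in 1%VS ->
  exists f : cochain (gal_of {:L}), forall g0 g1,
    coboundary 1 f [:: g0; g1] = chi x [:: g0] * chi (u * v) [:: g1].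
Proof.
move=> u0 v0 x0 u2 v2 x2 uv2.
pose t g := if sqrt_sign g x then v else u.
pose t' g := if sqrt_sign g x then u else v.
pose e g := g u != t g.
have tt' g : t g * t' g = u * v by rewrite /t /t'; case: ifP; rewrite // mulrC.
have t0 g : t g != 0 by rewrite /t; case: ifP.
have gu g : g u = (-1) ^+ e g * t g.
  have : g u ^+ 2 = t g ^+ 2.
    rewrite -rmorphXn u2 rmorphD rmorph1 /= (sqrt_signE g x2) /t.
    by case: sqrt_sign; rewrite ?u2 ?v2 ?mulN1r ?mul1r.
  rewrite /e => /sqr_eq_sign[[] ->].
    by case: eqP => [->|]; rewrite ?mul1r.
  by rewrite mul1r eqxx mul1r.
have gv g : g v = (-1) ^+ (sqrt_sign g (u * v) (+) e g) * t' g.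
  apply: (mulfI (_ : g u != 0)); first by rewrite fmorph_eq0.
  rewrite -rmorphM /= (sqrt_signE g uv2) signr_addb gu -(tt' g) mulrACA.
  by congr (_ * _); rewrite mulrCA -expr2 sqrr_sign mulr1.
have eP g (k : bool) : g u = (-1) ^+ k * t g -> e g = k.
  rewrite /e => ->; case: k; last by rewrite mul1r eqxx.
  by rewrite mulN1r eq_sym -addr_eq0 -mulr2n -mulr_natl mulf_neq0 ?two_ext.
exists (fun gs => (e (head 1%g gs))%:R) => g0 g1; rewrite coboundary1 /chi /=.
have -> : e (g0 * g1)%g =
    e g0 (+) e g1 (+) (sqrt_sign g0 x && sqrt_sign g1 (u * v)).
  have tM : t (g0 * g1)%g = if sqrt_sign g0 x then t' g1 else t g1.
    by rewrite /t /t' sqrt_sign_galM //; do 2 case: sqrt_sign.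
  apply: eP; rewrite tM galM ?memvf // gu gal_sign /t.
  case: (sqrt_sign g0 x) => /=; last by rewrite gu addbF signr_addb mulrA.
  by rewrite gv !signr_addb -!mulrA; congr (_ * _); rewrite mulrCA.
rewrite !F2_addb; set p := (e g0)%:R; set q := (e g1)%:R.
have -> : (sqrt_sign g0 x && sqrt_sign g1 (u * v))%:R =
    (sqrt_sign g0 x)%:R * (sqrt_sign g1 (u * v))%:R :> 'F_2.
  by case: (sqrt_sign g0 x); rewrite ?mul1r ?mul0r.
set r := _ * _; rewrite [p + q]addrC addrA [q + (q + p)]addrA F2_addxx add0r.
by rewrite addrAC F2_addxx add0r.
Qed.

(** * Symbols as cup products of Kummer characters *)

Variable rt : F -> L.
Hypothesis rtE : forall b, rt b ^+ 2 = b%:A.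

Definition symbol (s : seq F) : cochain (gal_of {:L}) :=
  foldr (fun b => cup 1 (chi (rt b))) (fun=> 1) s.

Let Z (s : seq F) := is_coboundary G (size s) (symbol s).

Let rt0 b : b != 0 -> rt b != 0.
Proof. by move=> b0; rewrite -sqrf_eq0 rtE alg_eq0. Qed.

(** At [b = 0] the character is identically zero; this value is covered because [Z_cons] and
    [Z_swap] range over all of [F]. *)
Lemma chi_rt_cocycle b : is_cocycle G 1 (chi (rt b)).
Proof.
have [b0|/rt0 b0] := eqVneq b 0; last first.
  by apply: chi_cocycle; rewrite // rtE rpredZ ?rpred1.
have r0 : rt b = 0 by apply/eqP; rewrite -sqrf_eq0 rtE b0 scale0r.
move=> gs /on_G_S[g0 [t0 [-> _]]] /on_G_S[g1 [t [-> _ []]]].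
by case: t => // _ _; rewrite coboundary1 /chi /sqrt_sign r0 !rmorph0 eqxx !addr0.
Qed.

Lemma symbol_cocycle s : is_cocycle G (size s) (symbol s).
Proof.
elim: s => [|b s IH]; last exact: is_cocycle_cup1 (chi_rt_cocycle b) IH.
by move=> gs _; rewrite coboundaryE big_ord0 addr0 F2_addxx.
Qed.

Lemma symbol_cons b s g t : symbol (b :: s) (g :: t) = chi (rt b) [:: g] * symbol s t.
Proof. exact: cup1_cons. Qed.

Lemma symbol_coboundary (n : nat) (s : seq F) :
    ~ formally_real F -> square_class_card F (2 ^ n) ->
    (n < size s)%N -> all (fun x => x != 0) s ->
  is_coboundary G (size s) (symbol s).
Proof.
apply: (@symbol_vanish F Z).
- by move=> a s' Zs; apply: is_coboundary_cup1 Zs; apply: chi_rt_cocycle.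
- move=> a b s' a0 b0 Za Zb; apply: is_coboundary_ext (is_coboundaryD Za Zb).
  move=> gs /on_G_S[g [t [-> _ _]]]; rewrite !symbol_cons -mulrDl; congr (_ * _).
  rewrite /chi -F2_addb -sqrt_signM ?rt0 ?rtE ?rpredZ ?rpred1 //=; congr (nat_of_bool _)%:R.
  by apply: sqrt_sign_sqr; rewrite exprMn !rtE -(rmorphM (in_alg L)).
- move=> a b s' Zab.
  (* By [F2_polar], its coboundary is the sum of the two cup products. *)
  pose f : cochain (gal_of {:L}) := fun gs => chi (rt a) gs * chi (rt b) gs.
  have := is_coboundaryD Zab (is_coboundary_cup2 f (@symbol_cocycle s')).
  apply: is_coboundary_ext => gs /on_G_S[g0 [t0 [-> G0]]] /on_G_S[g1 [t [-> G1 _]]].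
  rewrite !symbol_cons !mulrA /= take0 drop0 -mulrDl; congr (_ * _).
  rewrite coboundary1 /f !(cocycle1M (chi_rt_cocycle _) G0 G1).
  exact: F2_polar.
- move=> c s' c0; apply: is_coboundary_ext (is_coboundary0 _ _) => gs.
  (* The scalar [c] is itself a square root of [c ^+ 2], and it is fixed by the Galois group. *)
  case/on_G_S=> [g [t [-> _ _]]]; rewrite symbol_cons /chi /=.
  rewrite (@sqrt_sign_sqr g _ (c%:A)); last by rewrite rtE -(rmorphXn (in_alg L)).
  by rewrite /sqrt_sign linearZ /= rmorph1 eqxx mul0r.
move=> a b s' a0 b0 ab1.
(* Here [x] and [u * v] are square roots of [a] and [b], so their characters are those of [rt a] and
   [rt b], and [dihedral_cup] provides the primitive. *)
have [x [u [v [x2 u2 v2 uv2]]]] := W_closure_dihedral a0 b0 ab1.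
have x0 : x != 0 by rewrite -sqrf_eq0 x2 alg_eq0.
have [u0 v0] : u != 0 /\ v != 0.
  by apply/andP; rewrite -negb_or -mulf_eq0 -sqrf_eq0 uv2 alg_eq0.
have [||f fE] := dihedral_cup u0 v0 x0 u2 v2.
- by rewrite x2 rpredZ ?rpred1.
- by rewrite uv2 rpredZ ?rpred1.
apply: is_coboundary_ext (is_coboundary_cup2 f (@symbol_cocycle s')).
move=> gs /on_G_S[g0 [t0 [-> G0]]] /on_G_S[g1 [t [-> G1 _]]].
rewrite !symbol_cons /= take0 drop0 fE mulrA /chi /=.
by rewrite (@sqrt_sign_sqr g0 x (rt a)) ?(@sqrt_sign_sqr g1 (u * v) (rt b)) ?rtE.
Qed.

(** Each factor is a Kummer character by [cocycle1_chi], whose root [y] may be replaced by the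
    chosen [rt b]. *)
Lemma H1_product_symbol k f : H1_product G k f ->
  exists s : seq F, [/\ size s = k, all (fun x => x != 0) s
    & forall gs, on_G G k gs -> f gs = symbol s gs].
Proof.
elim=> [|{}k a {}f ca _ [s [sz s0 fE]]]; first by exists [::].
have [b [y [b0 y2 aE]]] := cocycle1_chi ca.
exists (b :: s); split; rewrite /= ?sz ?b0 //.
move=> gs /on_G_S[g [t [-> Gg Gt]]].
rewrite !cup1_cons aE // fE // /chi /=.
by rewrite (@sqrt_sign_sqr g y (rt b)) ?rtE.
Qed.

End WClosure.

Theorem theorem3p21 (F : fieldType) (n : nat) :
  ~ (2%N \in [pchar F]%R) ->
  ~ formally_real F ->
  square_class_card F (2 ^ n) ->
  forall L : splittingFieldType F, W_closure L ->
  c_le ('Gal({:L}%VS / 1%VS))%g n.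
Proof.
move=> nchar2 nreal card L WL k lt_nk f [s [sH fE]].
have two : (2%:R : F) != 0 by apply/negP => two; apply: nchar2; apply/andP.
have ex_rt b : exists y : L, y ^+ 2 == b%:A.
  by have [y /eqP] := W_closure_sqrt two WL b; exists y.
pose rt b := xchoose (ex_rt b).
have rtE b : rt b ^+ 2 = b%:A by apply/eqP/(xchooseP (ex_rt b)).
(* By additivity it suffices to treat one product, which agrees on [G] with a symbol of length
   [k]. *)
apply: (@is_coboundary_ext _ 'Gal({:L} / 1)%G k (fun gs => \sum_(a <- s) a gs)).
  by move=> gs Ggs; rewrite fE.
apply: is_coboundary_sum => i /sH /(H1_product_symbol two WL rtE)[t [sz t0 tE]].
apply: (is_coboundary_ext (f := symbol rt t)); first by move=> gs /tE.
by rewrite -sz in lt_nk *; apply: symbol_coboundary card _ t0.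
Qed.
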